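(* For integers $b\ge0$ and $n\ge1$, let $ss_b(n)$ be the number of multiplex siteswaps of length $n$ using exactly $b$ balls. Then \[ ss_b(n)=\operatorname{trace}(A_b^n)-\sum_{i=0}^{b-1}\operatorname{trace}(A_i^n). \]
   Context: For an integer $b\ge 0$, an ordered partition of $b$ is a finite sequence $(q_1,\ldots,q_k)$ of positive integers summing to $b$ (for $b=0$ the only one is the empty sequence). An ordered partition $(q_1,\ldots,q_k)$ with $k\ge1$ is nontrivially embedded into an ordered partition $(r_1,\ldots,r_\ell)$ by a choice of indices $1\le i_2<\cdots<i_k\le \ell$ with $q_j\le r_{i_j}$ for $2\le j\le k$; different index tuples count as different embeddings. A card for $b$ balls is either (i) a trivial card, given by an ordered partition $q$ of $b$, with left and right partitions both $q$; or (ii) a throw card, given by ordered partitions $q$ ($k\ge1$ parts) and $r$ of $b$ together with a nontrivial embedding of $q$ into $r$, with left partition $q$ and right partition $r$. Different index tuples give different cards, and a throw card is distinct from the trivial card even when $q=r$. $A_b$ is the square matrix with rows and columns indexed by the ordered partitions of $b$ whose $(u,v)$ entry is the number of cards for $b$ balls with left partition $u$ and right partition $v$ (e.g. $A_0=(1)$, $A_1=(2)$). A multiplex siteswap of length $n$ is a sequence $(M_0,\ldots,M_{n-1})$, indexed by $t\in\mathbb{Z}/n\mathbb{Z}$, of finite multisets of positive integers ($M_t$ is the multiset of throw heights at beat $t$; empty means no throw) such that for every $t$, $|M_t|$ equals the number of pairs $(s,h)$ with $h$ an element of $M_s$ (counted with multiplicity) and $s+h\equiv t \pmod n$. Its number of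 balls is $\frac1n\sum_t\sum_{h\in M_t}h$. Sequences differing by a rotation are counted as different. *)

(* Defs.v *)
From mathcomp Require Import all_boot all_order all_algebra.
Set Implicit Arguments. Unset Strict Implicit. Unset Printing Implicit Defensive.
Import Order.TTheory GRing.Theory Num.Theory.

(* Ordered partitions (compositions) of b, enumerated with fuel f >= b. *)
Fixpoint compsF (f b : nat) : seq (seq nat) :=
  match f with
  | 0 => if b == 0 then [:: [::]] else [::]
  | f'.+1 =>
      if b == 0 then [:: [::]]
      else flatten [seq map (cons q) (compsF f' (b - q)) | q <- iota 1 b]
  end.

Definition comps (b : nat) : seq (seq nat) := compsF b b.

(* emb q r = number of strictly increasing index tuples choosing, for each
   part x of q (in order), a part y of r with x <= y. *)
Fixpoint emb (q r : seq nat) : nat :=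
  match r with
  | [::] => if q is [::] then 1 else 0
  | y :: r' =>
      match q with
      | [::] => 1
      | x :: q' => emb q r' + (x <= y) * emb q' r'
      end
  end.

(* number of cards with left partition u and right partition v:
   one trivial card if u = v, plus the throw cards, i.e. the nontrivial
   embeddings of u = (q_1,...,q_k), k >= 1, into v (constraints on q_2..q_k). *)
Definition ncards (u v : seq nat) : nat :=
  (u == v) + (if u is _ :: u' then emb u' v else 0).

Definition Amx (b : nat) : 'M[int]_(size (comps b)) :=
  \matrix_(i, j) Posz (ncards (nth [::] (comps b) i) (nth [::] (comps b) j)).

(* A multiplex siteswap of length n with b balls, as a sequence of n
   multisets; each multiset of throw heights is represented canonically
   as a sorted (nondecreasing) list of positive integers. *)
Definition is_mss (b n : nat) (M : seq (seq nat)) : Prop :=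
  [/\ size M = n,
      forall t, t < n -> sorted leq (nth [::] M t),
      forall t, t < n -> all (fun h => 0 < h) (nth [::] M t),
      forall t, t < n ->
        size (nth [::] M t) =
        \sum_(s < n) count (fun h => (s + h) %% n == t) (nth [::] M s)
    & \sum_(s < n) sumn (nth [::] M s) = b * n].

(* Main.v *)
Require Import Defs.
From mathcomp Require Import all_boot all_order all_algebra zify.
Import GRing.Theory Num.Theory.

(** A state of the juggler is a composition [u] together with the strictly
    increasing list [p] of the times at which its groups are due; throws are the
    differences of consecutive states. A card lifts uniquely backwards: the times
    of its right partition determine those of its left partition. Hence a closed
    card walk [w] acts on the time lists of its base point, and the siteswaps with
    [b] balls are the closed walks together with a fixed point of this action.

    If every card of [w] sends the last group to the last group, the last due time
    grows by the length of [w], so there is no fixed point. Otherwise every turn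
    around [w] determines one more due time, an iterate of the action is constant
    and the fixed point exists and is unique. Finally, in a closed walk of the first
    kind the last group has a constant size [c > 0], and deleting it gives an
    arbitrary closed walk for [b - c] balls; these are the subtracted traces. *)

Set Implicit Arguments.
Unset Strict Implicit.
Unset Printing Implicit Defensive.

(** * Enumeration of ordered partitions *)

Lemma leq_sumn (s : seq nat) (x : nat) : x \in s -> x <= sumn s.
Proof. by move=> xs; rewrite sumnE (big_rem x) //= leq_addr. Qed.

Lemma mem_compsF (f b : nat) (u : seq nat) : b <= f ->
  (u \in compsF f b) = (sumn u == b) && all (leq 1) u.
Proof.
have zero (v : seq nat) : (v \in [:: [::]]) = (sumn v == 0) && all (leq 1) v.
  by case: v => [|[|x] v] //=; rewrite andbF.
elim: f b u => [|f IH] b u; first by rewrite leqn0 => /eqP ->.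
case: b => [|b] hb; first exact: zero.
apply/flatten_mapP/idP => [[q]|].
  rewrite (mem_iota 1 b.+1) => /andP[q0 qb] /mapP[v].
  rewrite IH; last by lia.
  by move=> /andP[/eqP sv av] -> /=; rewrite q0 av sv !andbT; lia.
case: u => [|q u] //= /andP[/eqP su /andP[q0 au]].
exists q; first by rewrite (mem_iota 1 b.+1); lia.
rewrite map_f // IH; last by lia.
by rewrite au andbT; lia.
Qed.

Lemma mem_comps (b : nat) (u : seq nat) :
  (u \in comps b) = (sumn u == b) && all (leq 1) u.
Proof. exact: mem_compsF. Qed.

Lemma compsF_uniq (f b : nat) : uniq (compsF f b).
Proof.
elim: f b => [|f IH] b /=; first by case: ifP.
case: ifP => // _.
apply: (@allpairs_uniq_dep _ (fun _ => seq nat : eqType) _ (fun q v => q :: v)).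
- exact: iota_uniq.
- by move=> q _; apply: IH.
- by move=> [q v] [q' v'] _ _ /= [-> ->].
Qed.

Lemma comps_uniq (b : nat) : uniq (comps b).
Proof. exact: compsF_uniq. Qed.

(** * Embeddings and cards *)

(* An embedding is recorded as the mask selecting the parts i_2 < ... < i_k. *)
Fixpoint masks (q r : seq nat) : seq bitseq :=
  match r with
  | [::] => if q is [::] then [:: [::]] else [::]
  | y :: r' =>
      match q with
      | [::] => [:: nseq (size r) false]
      | x :: q' => map (cons false) (masks q r') ++
                   (if x <= y then map (cons true) (masks q' r') else [::])
      end
  end.

Lemma size_masks (q r : seq nat) : size (masks q r) = emb q r.
Proof.
elim: r q => [|y r IH] [|x q] //=.
by rewrite size_cat size_map IH; case: leqP => _; rewrite ?size_map ?IH ?mul1n.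
Qed.

Lemma masks_uniq (q r : seq nat) : uniq (masks q r).
Proof.
elim: r q => [|y r IH] [|x q] //=.
have consI (b : bool) : injective (cons b) by move=> ? ? [].
rewrite cat_uniq map_inj_uniq // IH /=; case: ifP => //= _.
rewrite map_inj_uniq // IH andbT.
by apply/hasPn => _ /mapP[m _ ->]; apply/negP => /mapP[].
Qed.

Lemma mem_masks (q r : seq nat) (m : bitseq) :
  (m \in masks q r) = (size m == size r) && all2 leq q (mask m r).
Proof.
elim: r q m => [|y r IH] [|x q] [|c m] //=.
- rewrite inE /= eqseq_cons eqSS; case: c => /=; first by rewrite andbF.
  have <- : (m \in [:: nseq (size r) false]) = (size m == size r) && all2 leq [::] (mask m r).
    rewrite -[in RHS]IH.
    by case: r {IH}.
  by rewrite inE.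
- rewrite mem_cat; case: ifP => _; rewrite ?orbF; last by apply/negP => /mapP[].
  by apply/negP => /orP[] /mapP[].
rewrite mem_cat eqSS.
have consI (b : bool) : injective (cons b) by move=> ? ? [].
have consN (b : bool) s : (~~ b :: m \in map (cons b) s) = false.
  by apply/negP => /mapP[? _ [/eqP]]; case: b.
case: c => /=.
  rewrite (consN false) /=; case: leqP => _ /=; last by rewrite andbF.
  by rewrite mem_map // IH.
rewrite mem_map // IH; case: leqP => _ //=; last by rewrite orbF.
by rewrite (consN true) orbF.
Qed.

(* [None] is the trivial card, [Some m] the throw card with embedding [m]. *)
Definition is_card (u : seq nat) (m : option bitseq) (r : seq nat) : bool :=
  match m, u with
  | None, _ => u == r
  | Some m, [::] => false
  | Some m, _ :: u' => (size m == size r) && all2 leq u' (mask m r)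
  end.

Definition cards (u r : seq nat) : seq (option bitseq) :=
  (if u == r then [:: None] else [::]) ++
  (if u is _ :: u' then map Some (masks u' r) else [::]).

Lemma size_cards (u r : seq nat) : size (cards u r) = ncards u r.
Proof.
rewrite /cards /ncards size_cat; case: u => [|x u]; case: ifP => //= _.
  by rewrite size_map size_masks.
by rewrite size_map size_masks.
Qed.

Lemma cards_uniq (u r : seq nat) : uniq (cards u r).
Proof.
rewrite /cards cat_uniq; apply/and3P; split; first by case: ifP.
  case: u => // x u; apply/hasPn => _ /mapP[m _ ->].
  by case: ifP; rewrite ?inE.
by case: u => // x u; rewrite map_inj_uniq ?masks_uniq // => ? ? [].
Qed.

Lemma mem_cards (u r : seq nat) (m : option bitseq) :
  (m \in cards u r) = is_card u m r.
Proof.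
rewrite /cards mem_cat; case: m => [m|].
  have -> /= : (Some m \in (if u == r then [:: None] else [::])) = false.
    by case: ifP; rewrite ?inE.
  case: u => // x u; rewrite mem_map ?mem_masks // => ? ? [] //.
case: ifP => e; first by rewrite /= e.
rewrite /= e; case: u {e} => // x u.
by apply/negP => /mapP[].
Qed.

(** * Walks of cards and traces of matrix powers *)

(* A walk is the list of its (card, target partition) pairs. *)
Notation walk := (seq (option bitseq * seq nat)).

Fixpoint is_walk (b : nat) (u v : seq nat) (w : walk) : bool :=
  if w is (m, r) :: w' then [&& is_card u m r, r \in comps b & is_walk b r v w']
  else u == v.

Fixpoint walks (b n : nat) (u v : seq nat) : seq walk :=
  if n is n'.+1 then
    [seq c :: w | c <- [seq (m, r) | r <- comps b, m <- cards u r],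
                  w <- walks b n' c.2 v]
  else if u == v then [:: [::]] else [::].

Lemma walks_uniq (b n : nat) (u v : seq nat) : uniq (walks b n u v).
Proof.
elim: n u => [|n IH] u /=; first by case: ifP.
apply: (@allpairs_uniq_dep _ (fun _ => walk : eqType) _ (fun c w => c :: w)).
- apply: (@allpairs_uniq_dep _ (fun _ => option bitseq : eqType) _ (fun r m => (m, r))).
  + exact: comps_uniq.
  + by move=> r _; apply: cards_uniq.
  + by move=> [r m] [r' m'] _ _ /= [-> ->].
- by move=> c _; apply: IH.
- by move=> [c w] [c' w'] _ _ /= [-> ->].
Qed.

Lemma mem_walks (b n : nat) (u v : seq nat) (w : walk) :
  (w \in walks b n u v) = (size w == n) && is_walk b u v w.
Proof.
elim: n u w => [|n IH] u w /=.
  case: ifP => e; first by rewrite inE; case: w => [|[]] /=; rewrite ?e.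
  by case: w => [|[]] /=; rewrite ?e.
apply/allpairsPdep/idP => [[c [w' [/allpairsPdep[r [m [hr hm ->]]] hw ->]]]|].
  by move: hw; rewrite IH /= eqSS mem_cards in hm * => /andP[-> ->]; rewrite hm hr.
case: w => [|[m r] w] //=; rewrite eqSS => /andP[sw /and3P[hm hr hw]].
exists (m, r), w; split => //=; last by rewrite IH sw.
by apply/allpairsPdep; exists r, m; rewrite mem_cards.
Qed.

Lemma size_walks (b n : nat) (u v : seq nat) :
  size (walks b n.+1 u v) =
  \sum_(r <- comps b) ncards u r * size (walks b n r v).
Proof.
rewrite /= size_allpairs_dep sumnE big_map.
rewrite big_allpairs_dep; apply: eq_bigr => r _ /=.
by rewrite big_const_seq count_predT iter_addn_0 size_cards mulnC.
Qed.

Lemma Amx_exp (b n : nat) (i j : 'I_(size (comps b))) :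
  ((Amx b ^+ n)%R i j =
   (size (walks b n (nth [::] (comps b) i) (nth [::] (comps b) j)))%:Z)%R.
Proof.
elim: n i => [|n IH] i.
  rewrite expr0 mxE /= nth_uniq ?comps_uniq // -val_eqE /=.
  by case: ifP.
rewrite exprS [LHS]mxE size_walks (big_nth [::]) big_mkord.
rewrite -natz raddf_sum /=; apply: eq_bigr => k _.
by rewrite IH mxE natz PoszM.
Qed.

Definition closed_walks (b n : nat) : seq (seq nat * walk) :=
  [seq (u, w) | u <- comps b, w <- walks b n u u].

Lemma closed_walks_uniq (b n : nat) : uniq (closed_walks b n).
Proof.
apply: (@allpairs_uniq_dep _ (fun _ => walk : eqType) _ (fun u w => (u, w))).
- exact: comps_uniq.
- by move=> u _; apply: walks_uniq.
- by move=> [u w] [u' w'] _ _ /= [-> ->].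
Qed.

Lemma mem_closed_walks (b n : nat) (u : seq nat) (w : walk) :
  ((u, w) \in closed_walks b n) =
  [&& u \in comps b, size w == n & is_walk b u u w].
Proof.
apply/allpairsPdep/idP => [[u' [w' [hu hw [-> ->]]]]|/and3P[hu sw hw]].
  by rewrite hu -mem_walks.
by exists u, w; rewrite mem_walks sw.
Qed.

Lemma size_closed_walks (b n : nat) :
  ((size (closed_walks b n))%:Z = \tr (Amx b ^+ n))%R.
Proof.
rewrite size_allpairs_dep sumnE big_map (big_nth [::]) big_mkord.
by rewrite -natz raddf_sum; apply: eq_bigr => i _; rewrite Amx_exp -natz.
Qed.

(** * Walks that keep the last group last *)

Lemma all2_rcons (T U : Type) (e : T -> U -> bool) (s : seq T) (t : seq U) x y :
  all2 e (rcons s x) (rcons t y) = all2 e s t && e x y.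
Proof.
rewrite !all2E !size_rcons eqSS; case: eqP => //= st.
by rewrite zip_rcons // all_rcons /= andbC.
Qed.

(** A mask ending in [true] sends the last group to the last group. If the left partition has a
    single part, that part is thrown and the mask selects nothing, so the test fails as it
    should. *)
Definition top_fixing (w : walk) : bool :=
  all (fun c => if c.1 is Some m then last false m else true) w.

Definition add_top (c : nat) (w : walk) : walk :=
  [seq (omap (rcons^~ true) x.1, rcons x.2 c) | x <- w].

Lemma is_card_rcons (u r : seq nat) (m : option bitseq) (c d : nat) :
  is_card (rcons u c) (omap (rcons^~ true) m) (rcons r d) =
  is_card u m r && (if m is Some _ then c <= d else c == d).
Proof.
case: m => [m|] /=; last by rewrite eqseq_rcons.
case: u => [|x u] /=; rewrite !size_rcons eqSS; case: eqP => //= smr;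
  rewrite mask_rcons //= cats1; last exact: all2_rcons.
by case: (mask m r).
Qed.

Lemma is_card_top (u r : seq nat) (m : option bitseq) (c : nat) :
  is_card (rcons u c) m r -> (if m is Some m then last false m else true) ->
  exists r0 d m0, [/\ r = rcons r0 d, m = omap (rcons^~ true) m0, c <= d &
                      is_card u m0 r0].
Proof.
case: m => [m|] hc lm; last first.
  by move/eqP: hc => <-; exists u, c, None; split => //=.
case/lastP: m lm hc => [|m t] //; rewrite last_rcons => ->.
case/lastP: r => [|r d] hc.
  by case: u hc => //= [|x u]; rewrite size_rcons.
exists r, d, (Some m); move: hc.
by rewrite (is_card_rcons u r (Some m) c d) => /andP[-> ->].
Qed.

Lemma mem_comps_rcons (b c : nat) (u : seq nat) :
  (rcons u c \in comps b) = (0 < c <= b) && (u \in comps (b - c)).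
Proof. by rewrite !mem_comps sumn_rcons all_rcons; lia. Qed.

Lemma is_walk_add_top (b c : nat) (u v : seq nat) (w : walk) : 0 < c <= b ->
  is_walk (b - c) u v w -> is_walk b (rcons u c) (rcons v c) (add_top c w).
Proof.
move=> cb; elim: w u => [|[m r] w IH] u /=; first by move=> /eqP ->.
move=> /and3P[hm hr /IH ->]; rewrite is_card_rcons hm mem_comps_rcons cb hr.
by case: m {hm}; rewrite /= ?leqnn ?eqxx.
Qed.

Lemma top_fixing_add_top (c : nat) (w : walk) : top_fixing (add_top c w).
Proof. by apply/allP => _ /mapP[[[m|] r] _ ->] //=; rewrite last_rcons. Qed.

(* The last part can only grow along a top-fixing walk, hence is constant on a closed one. *)
Lemma top_fixingP (b c : nat) (u v : seq nat) (w : walk) :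
  is_walk b (rcons u c) v w -> top_fixing w ->
  exists v0 d, [/\ v = rcons v0 d, c <= d &
    d = c -> exists2 w0, w = add_top c w0 & is_walk (b - c) u v0 w0].
Proof.
elim: w u c => [|[m r] w IH] u c /=.
  by move=> /eqP <- _; exists u, c; split=> // _; exists [::] => //=.
move=> /and3P[hm hr hw] /andP[tm tw].
have [r0 [d [m0 [er em cd hm0]]]] := is_card_top hm tm.
rewrite {}er {}em in hr hw hm *.
have [v0 [e [-> de hv]]] := IH _ _ hw tw.
exists v0, e; split=> [//||ec]; first exact: leq_trans cd de.
have dc : d = c by apply/eqP; rewrite eqn_leq cd andbT -ec.
subst d; have [w0 -> hw0] := hv ec.
exists ((m0, r0) :: w0) => //=.
by rewrite hm0 hw0 andbT; move: hr; rewrite mem_comps_rcons => /andP[].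
Qed.

(** For [b = 0] every walk passes [top_fixing] although there is no last group, hence the guard
    [0 < b]. *)
Definition top_fixing_walks (b n : nat) : seq (seq nat * walk) :=
  [seq x <- closed_walks b n | (0 < b) && top_fixing x.2].

(** Deleting a last group of size [b - i] and restoring it by [add_top] matches these walks with the
    closed walks for [i] balls; a size between 1 and [b] means [i < b]. *)
Lemma size_top_fixing_walks (b n : nat) :
  size (top_fixing_walks b n) = \sum_(i < b) size (closed_walks i n).
Proof.
pose t := [seq (rcons x.1 (b - i), add_top (b - i) x.2) | i <- iota 0 b, x <- closed_walks i n].
have addI c : injective (add_top c).
  apply: inj_map => -[m r] [m' r'] /= [em er].
  have [->] := rcons_inj er.
  case: m m' em => [m|] [m'|] //= [em].
  by have [->] := rcons_inj em.
have ut : uniq t.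
  apply: (@allpairs_uniq_dep _ (fun _ => (seq nat * walk)%type : eqType) _
            (fun i x => (rcons x.1 (b - i), add_top (b - i) x.2))).
  - exact: iota_uniq.
  - by move=> i _; apply: closed_walks_uniq.
  - move=> [i [u w]] [j [u' w']] /allpairsPdep[i' [x [hi _ [ei _]]]].
    move=> /allpairsPdep[j' [y [hj _ [ej _]]]] /= [/rcons_inj[-> eij]].
    rewrite -ei -ej !mem_iota /= !add0n in hi hj eij *.
    have -> : i = j by rewrite ei ej; lia.
    by move=> /addI ->.
have /perm_size -> : perm_eq (top_fixing_walks b n) t.
  apply: uniq_perm => //; first by rewrite filter_uniq ?closed_walks_uniq.
  move=> [u w]; rewrite mem_filter mem_closed_walks /=.
  apply/idP/allpairsPdep.
    move=> /andP[/andP[b0 tw] /and3P[hu sw hw]].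
    case/lastP: u hu hw => [|u c] hu hw.
      by move: hu; rewrite mem_comps /= => /andP[/eqP e]; rewrite -e in b0.
    have [v0 [d [/rcons_inj[<- <-] _ /(_ erefl)[w0 ew hw0]]]] := top_fixingP hw tw.
    move: hu; rewrite mem_comps_rcons => /andP[cb hu].
    exists (b - c), (u, w0); rewrite mem_iota mem_closed_walks hu hw0 andbT.
    rewrite -(eqP sw) ew size_map eqxx; split=> //; first by lia.
    by have -> : b - (b - c) = c by lia.
  move=> [i [[u' w']]] [] /=; rewrite mem_iota mem_closed_walks => ib.
  move=> /and3P[hu sw hw] [-> ->]; rewrite top_fixing_add_top mem_comps_rcons.
  have bi : 0 < b - i <= b by lia.
  have ebi : b - (b - i) = i by lia.
  by rewrite is_walk_add_top ?ebi // hu size_map sw bi !andbT /=; lia.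
rewrite size_allpairs_dep sumnE big_map.
by rewrite -[in iota 0 b](subn0 b) -/(index_iota 0 b) big_mkord.
Qed.

(** * States as finitely supported functions *)

(* A state: the group of [nth 0 u j] balls is due to land [nth 0 p j] beats from now. *)
Definition is_state (u p : seq nat) : bool :=
  [&& size p == size u, sorted ltn p & all (leq 1) u].

(** For an absent time [index] returns [size p], which is past the end of [u] in a state, so the
    default makes the value 0. *)
Definition due (u p : seq nat) (i : nat) : nat := nth 0 u (index i p).

Lemma is_state_uniq (u p : seq nat) : is_state u p -> uniq p.
Proof. by case/and3P=> _ sp _; exact: (sorted_uniq ltn_trans ltnn). Qed.

Lemma due_gt0 (u p : seq nat) (i : nat) :
  is_state u p -> (0 < due u p i) = (i \in p).
Proof.
case/and3P=> /eqP sp _ /(all_nthP 0) u0; rewrite /due -index_mem sp.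
by case: (ltnP (index i p) (size u)) => hi; [rewrite u0 | rewrite nth_default].
Qed.

Lemma due_out (u p : seq nat) (i : nat) :
  is_state u p -> i \notin p -> due u p i = 0.
Proof. by move=> hs; rewrite -(due_gt0 i hs); case: due. Qed.

Lemma map_due (u p : seq nat) : is_state u p -> map (due u p) p = u.
Proof.
move=> hs; have up := is_state_uniq hs; case/and3P: hs => /eqP sp _ _.
apply: (@eq_from_nth _ 0); rewrite size_map // => i hi.
by rewrite (nth_map 0) // /due index_uniq.
Qed.

(** The support of [due u p] is [p] and its values along [p] are [u]. With [due_surj], states are
    the same as finitely supported functions. *)
Lemma due_inj (u p u' p' : seq nat) : is_state u p -> is_state u' p' ->
  due u p =1 due u' p' -> u = u' /\ p = p'.
Proof.
move=> hs hs' e.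
have ep : p = p'.
  case/and3P: (hs) (hs') => _ s1 _ /and3P[_ s2 _].
  apply: (irr_sorted_eq ltn_trans ltnn s1 s2) => i.
  by rewrite -(due_gt0 i hs) -(due_gt0 i hs') e.
split=> //; have := map_due hs'; have := map_due hs; rewrite -{}ep in e *.
by move=> <- <-; apply: eq_map.
Qed.

Lemma due_surj (f : nat -> nat) (N : nat) : (forall i, N <= i -> f i = 0) ->
  exists u p, is_state u p /\ due u p =1 f.
Proof.
move=> fN; pose p := [seq i <- iota 0 N | 0 < f i].
have due_p i : due (map f p) p i = f i.
  rewrite /due; case: (boolP (i \in p)) => hi.
    by rewrite (nth_map 0) ?index_mem // nth_index.
  rewrite nth_default; last by rewrite size_map leqNgt index_mem.
  case: (leqP N i) => [/fN ->//|iN].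
  by move: hi; rewrite mem_filter mem_iota iN andbT; case: (f i).
exists (map f p), p; split=> //; apply/and3P; split.
- by rewrite size_map.
- by apply: sorted_filter; [exact: ltn_trans | exact: iota_ltn_sorted].
- by apply/allP => _ /mapP[i + ->]; rewrite mem_filter => /andP[].
Qed.

(** A common range of summation lets two consecutive states be compared after a shift by one. *)
Lemma sum_due (F : nat -> nat) (u p : seq nat) (N : nat) :
  is_state u p -> (forall i, i \in p -> i < N) ->
  \sum_(i <- p) F i * due u p i = \sum_(i < N) F i * due u p i.
Proof.
move=> hs pN.
have ep : [seq i <- iota 0 N | 0 < due u p i] = p.
  case/and3P: (hs) => _ sp _; apply: (irr_sorted_eq ltn_trans ltnn) => //.
    by apply: sorted_filter; [exact: ltn_trans | exact: iota_ltn_sorted].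
  move=> i; rewrite mem_filter (due_gt0 i hs) mem_iota add0n /=.
  by case: (boolP (i \in p)) => // /pN ->.
rewrite -{1}ep big_filter -[in LHS](subn0 N) -/(index_iota 0 N) big_mkord.
rewrite [RHS](bigID (fun i : 'I_N => 0 < due u p i)) /=.
rewrite [X in _ + X]big1 ?addn0 // => i.
by rewrite lt0n negbK => /eqP ->; rewrite muln0.
Qed.

Lemma sumn_due (u p : seq nat) : is_state u p ->
  sumn u = \sum_(i <- p) due u p i.
Proof. by move=> hs; rewrite -{1}(map_due hs) sumnE big_map. Qed.

Lemma sum_count_mem (F : nat -> nat) (L : seq nat) (N : nat) :
  (forall h, h \in L -> 0 < h <= N) ->
  \sum_(h <- L) F h = \sum_(i < N) F i.+1 * count_mem i.+1 L.
Proof.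
elim: L => [|h L IH] hL.
  by rewrite big_nil big1 // => i _; rewrite muln0.
rewrite big_cons IH; last by move=> k hk; apply: hL; rewrite inE hk orbT.
under [RHS]eq_bigr => i _ do rewrite /= mulnDr.
rewrite big_split /=; congr addn.
have /andP[h0 hN] := hL h (mem_head _ _).
have hN' : h.-1 < N by lia.
rewrite (bigD1 (Ordinal hN')) //= prednK // eqxx muln1 big1 ?addn0 // => i.
rewrite -val_eqE /= => ne; case: eqP => [e|]; last by rewrite muln0.
by move: ne; rewrite e eqxx.
Qed.

(** * One beat of juggling *)

(** A beat lowers each remaining time by one, so a ball thrown at height [i.+1] is then due in [i]
    beats. What is due at time 0 lands and drops out. *)
Definition step (u p L r p' : seq nat) : Prop :=
  [/\ sorted leq L, all (leq 1) L &
      forall i, due r p' i = due u p i.+1 + count_mem i.+1 L].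

(** The surplus of the new state over the shifted old one. The subtraction truncates, so this is a
    step only if the shifted old state stays below the new one. *)
Definition throws (u p r p' : seq nat) : seq nat :=
  sort leq (flatten [seq nseq (due r p' i - due u p i.+1) i.+1 | i <- p']).

Lemma step_inj (u p L L' r p' : seq nat) :
  step u p L r p' -> step u p L' r p' -> L = L'.
Proof.
move=> [s1 /allP a1 e1] [s2 /allP a2 e2].
apply: (sorted_eq leq_trans anti_leq s1 s2).
apply/allP => -[|h] _ /=; last by apply/eqP/(@addnI (due u p h.+1)); rewrite -e1 -e2.
(* The step equation involves positive heights only; height 0 is excluded by positivity. *)
have z (s : seq nat) : {in s, forall x, 0 < x} -> count_mem 0 s = 0.
  by move=> hs; apply/count_memPn/negP => /hs.
by rewrite !z.
Qed.

Lemma throws_step (u p r p' : seq nat) : is_state r p' ->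
  (forall i, due u p i.+1 <= due r p' i) -> step u p (throws u p r p') r p'.
Proof.
move=> hs le; split.
- exact: sort_sorted leq_total _.
- by rewrite all_sort; apply/allP => h /flatten_mapP[i _ /nseqP[->]].
move=> i; rewrite count_sort count_flatten -map_comp sumnE big_map /=.
under eq_bigr => j _ do rewrite count_nseq /= eqSS.
case: (boolP (i \in p')) => hi.
  rewrite (bigD1_seq i) ?(is_state_uniq hs) //= eqxx mul1n big1 ?addn0 ?subnKC //.
  by move=> j /negPf ->.
have e := due_out hs hi; have := le i; rewrite e leqn0 => /eqP ->.
by rewrite big1_seq // => j /andP[_ hj]; case: eqP => // ji; rewrite -ji hj in hi.
Qed.

(** A conservation law for an arbitrary weight: the constant 1 counts balls, [id] adds up remaining
    times. *)
Lemma step_sum (F : nat -> nat) (u p L r p' : seq nat) :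
  is_state u p -> is_state r p' -> step u p L r p' ->
  \sum_(i <- p) F i * due u p i + \sum_(h <- L) F h =
  F 0 * due u p 0 + \sum_(i <- p') F i.+1 * due r p' i.
Proof.
move=> hs hs' [_ /allP L0 e].
pose N := (sumn p + sumn p' + sumn L).+1.
rewrite (@sum_due F u p N.+1 hs); last by move=> i /leq_sumn; rewrite /N; lia.
rewrite (@sum_due (F \o S) r p' N hs'); last by move=> i /leq_sumn; rewrite /N; lia.
rewrite (@sum_count_mem F L N); last first.
  by move=> h hL; rewrite L0 //=; have := leq_sumn hL; rewrite /N; lia.
rewrite big_ord_recl -addnA; congr addn; rewrite -big_split.
by apply: eq_bigr => i _; rewrite /= e mulnDr.
Qed.

Lemma step_sumn (u p L r p' : seq nat) :
  is_state u p -> is_state r p' -> step u p L r p' ->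
  sumn u + size L = due u p 0 + sumn r.
Proof.
move=> hs hs' /(step_sum (fun=> 1) hs hs'); rewrite mul1n.
rewrite (sumn_due hs) (sumn_due hs').
under eq_bigr do rewrite mul1n; under [in RHS]eq_bigr do rewrite mul1n.
by rewrite sum1_size.
Qed.

(** * Lifting cards and walks to due times *)

(** Under a throw card the first group is due now, and every other group one beat later than the
    group it joins. *)
Definition lift_card (m : option bitseq) (p : seq nat) : seq nat :=
  if m is Some m then 0 :: map S (mask m p) else map S p.

Lemma sorted_map_S (p : seq nat) : sorted ltn (map S p) = sorted ltn p.
Proof. by rewrite sorted_map. Qed.

Lemma index_map_S (i : nat) (p : seq nat) : index i.+1 (map S p) = index i p.
Proof. exact: index_map succn_inj _ _. Qed.

Lemma lift_card_state (b : nat) (u r p' : seq nat) (m : option bitseq) :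
  u \in comps b -> is_card u m r -> is_state r p' ->
  is_state u (lift_card m p').
Proof.
rewrite mem_comps => /andP[_ u0] hm /and3P[/eqP sp' so _].
case: m hm => [m|] /=; last first.
  move=> /eqP e; rewrite -{}e in sp' *.
  by rewrite /is_state size_map sp' eqxx sorted_map_S so.
case: u u0 => // x u u0 /andP[/eqP smr]; rewrite all2E => /andP[/eqP su _].
rewrite /is_state u0 /= size_map size_mask ?smr // su size_mask // eqxx andbT.
rewrite (path_sortedE ltn_trans) sorted_map_S sorted_mask //; last exact: ltn_trans.
by rewrite andbT; apply/allP => _ /mapP[i _ ->].
Qed.

(** On the left times this is the inequality of the embedding, an equality for the trivial card;
    elsewhere the left side is 0. *)
Lemma lift_card_due (b : nat) (u r p' : seq nat) (m : option bitseq) :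
  u \in comps b -> is_card u m r -> is_state r p' ->
  forall i, due u (lift_card m p') i.+1 <= due r p' i.
Proof.
move=> hu hm hs i; have hl := lift_card_state hu hm hs.
case: (boolP (i.+1 \in lift_card m p')) => hi; last by rewrite (due_out hl hi).
case: m hm hl hi => [m|] hm hl /= hi; last first.
  by rewrite /due index_map_S; rewrite (eqP hm).
case: u {hu} hm hl => // x u /andP[/eqP smr hall] hl.
(* [behead] removes the group at time 0, on which the card imposes no inequality. *)
have /(congr1 behead)/= eu := map_due hl.
move: hall; rewrite -[X in all2 _ X _]eu -[X in all2 _ _ (mask _ X)](map_due hs)
  -map_mask -map_comp.
move: hi; rewrite inE /= (mem_map succn_inj) => hi.
rewrite all2E => /andP[_ /allP].
have hz : (due (x :: u) (0 :: [seq j.+1 | j <- mask m p']) i.+1, due r p' i) \in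
   zip [seq (due (x :: u) (0 :: [seq j.+1 | j <- mask m p']) \o S) j | j <- mask m p']
       [seq due r p' j | j <- mask m p'].
  rewrite zip_map; apply/mapP; exists i => //.
by move=> /(_ _ hz).
Qed.

(** If a group is due at 0, take the throw card whose mask marks the times of [p'] inherited from
    [p]. If none is, a strict inequality anywhere would make the total of [r] exceed that of [u], so
    the card is trivial. *)
Lemma card_of_due (u p r p' : seq nat) : is_state u p -> is_state r p' ->
  sumn u = sumn r -> (forall i, due u p i.+1 <= due r p' i) ->
  exists2 m, is_card u m r & p = lift_card m p'.
Proof.
move=> hs hs' sur le.
have sub i : i.+1 \in p -> i \in p'.
  by rewrite -(due_gt0 _ hs) -(due_gt0 _ hs') => /leq_trans; apply.
case/and3P: (hs) (hs') => /eqP sp so u0 /and3P[/eqP sp' so' r0].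
pose p2 := [seq i <- p' | i.+1 \in p].
have ep2 : map S p2 = [seq i <- p | 0 < i].
  apply: (irr_sorted_eq ltn_trans ltnn).
  - by rewrite sorted_map_S; apply: sorted_filter => //; exact: ltn_trans.
  - by apply: sorted_filter => //; exact: ltn_trans.
  - move=> [|i]; rewrite mem_filter /=; first by apply/negP => /mapP[].
    rewrite (mem_map succn_inj) mem_filter.
    by case: (boolP (i.+1 \in p)) => // /sub ->.
case: (boolP (0 \in p)) => p0.
  have ep : p = 0 :: map S p2.
    rewrite ep2; move: so p0; clear; case: p => [//|x p] so p0.
    move: (so); rewrite /= (path_sortedE ltn_trans) => /andP[/allP ap _].
    have ex : x = 0 by move: p0; rewrite inE => /orP[/eqP //|/ap].
    rewrite {}ex in ap *; congr cons; apply/esym/all_filterP; exact/allP.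
  pose m := [seq i.+1 \in p | i <- p'].
  have em : mask m p' = p2 by rewrite /p2 filter_mask.
  exists (Some m); last by rewrite /= em.
  have eu := map_due hs; have er := map_due hs'.
  case: u eu sp {sur u0} hs le => [|x u] eu sp hs le; first by rewrite ep in sp.
  rewrite /= size_map sp' eqxx /= -[in mask m r]er -map_mask em.
  move: eu; rewrite {2}ep /= => -[_ <-]; rewrite -map_comp.
  rewrite all2E !size_map eqxx zip_map all_map; apply/allP => i _ /=; exact: le.
have ep : p = map S p2.
  rewrite ep2; apply/esym/all_filterP/allP => -[|//] h.
  by rewrite h in p0.
have hs2 : is_state u p2.
  by rewrite /is_state u0 -sp {1}ep size_map eqxx -sorted_map_S -ep so.
have due2 i : due u p2 i = due u p i.+1 by rewrite {2}/due ep index_map_S.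
have [eu e2] : u = r /\ p2 = p'.
  apply: (due_inj hs2 hs') => i; rewrite due2.
  apply/eqP; rewrite eqn_leq le /= leqNgt; apply/negP => lt.
  have: sumn u < sumn r; last by rewrite sur ltnn.
  rewrite (sumn_due hs2) (sumn_due hs').
  have ip : i \in p' by rewrite -(due_gt0 _ hs'); apply: leq_ltn_trans lt.
  have -> : \sum_(j <- p2) due u p2 j = \sum_(j <- p') due u p2 j.
    rewrite big_filter [RHS](bigID (fun j => j.+1 \in p)) /=.
    rewrite [X in _ = _ + X]big1 ?addn0 // => j hj.
    by rewrite due2; apply: due_out.
  rewrite (big_rem i ip) [X in _ < X](big_rem i ip) /= due2.
  rewrite -addSn; apply: leq_add => //; apply: leq_sum => j _; rewrite due2; exact: le.
by exists None; [rewrite /= eu | rewrite /= -e2].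
Qed.

Lemma mask_inj (T : eqType) (s : seq T) (m m' : bitseq) : uniq s ->
  size m = size s -> size m' = size s -> mask m s = mask m' s -> m = m'.
Proof.
elim: s m m' => [|x s IH] [|c m] [|c' m'] //= /andP[xs us] [sm] [sm'].
have nm (k : bitseq) : x \notin mask k s by apply: contra xs => /mem_mask.
case: c c' => [] [] /= e.
- by case: e => e; rewrite (IH m m').
- by have := nm m'; rewrite -e inE eqxx.
- by have := nm m; rewrite e inE eqxx.
- by rewrite (IH m m').
Qed.

(** Only a throw card puts a group at time 0, and the times in [p'] are distinct, so the selected
    times give back the mask. *)
Lemma lift_card_inj (u r p' : seq nat) (m m' : option bitseq) :
  is_state r p' -> is_card u m r -> is_card u m' r ->
  lift_card m p' = lift_card m' p' -> m = m'.
Proof.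
move=> hs; have us := is_state_uniq hs; case/and3P: hs => /eqP sp _ _.
case: m m' => [m|] [m'|] //=.
- case: u => // x u /andP[/eqP sm _] /andP[/eqP sm' _] [/(inj_map succn_inj) e].
  by congr Some; apply: (mask_inj us) => //; rewrite sp.
- by case: p' {sp us}.
- by case: p' {sp us}.
Qed.

Definition lift (w : walk) (p : seq nat) : seq nat :=
  foldr (fun c => lift_card c.1) p w.

Lemma lift_state (b : nat) (u v : seq nat) (w : walk) (p : seq nat) :
  u \in comps b -> is_walk b u v w -> is_state v p -> is_state u (lift w p).
Proof.
elim: w u => [|[m r] w IH] u hu /=; first by move=> /eqP ->.
move=> /and3P[hm hr hw] hp; exact: lift_card_state hu hm (IH _ hr hw hp).
Qed.

(** * Fixed points of closed walks *)

(** [d] bounds how many trailing entries may still depend on the starting list; it is the quantity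
    that decreases. *)
Definition agree (d : nat) (p1 p2 : seq nat) : Prop :=
  exists a b1 b2, [/\ p1 = a ++ b1, p2 = a ++ b2, size b1 = size b2 & size b1 <= d].

(** The prepended 0 is a known entry, and of the undetermined tail only the selected entries
    survive. A mask ending in [false] discards at least one of them, if any are left. *)
Lemma agree_lift_card (d : nat) (u r : seq nat) (m : option bitseq) (p1 p2 : seq nat) :
  is_card u m r -> size p1 = size r -> agree d p1 p2 ->
  agree (d - ~~ (if m is Some m then last false m else true))
        (lift_card m p1) (lift_card m p2).
Proof.
move=> hm sp [a [b1 [b2 [e1 e2 sb le]]]]; subst p1 p2.
case: m hm => [m|] hm /=; last first.
  by exists (map S a), (map S b1), (map S b2); rewrite -!map_cat !size_map subn0.
have sm : size m = size a + size b1.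
  by case: u hm => // x u /andP[/eqP -> _]; rewrite -sp size_cat.
have em : m = take (size a) m ++ drop (size a) m by rewrite cat_take_drop.
move: em sm; set m1 := take _ _; set m2 := drop _ _ => em sm.
have s1 : size m1 = size a by rewrite size_takel // sm leq_addr.
have s2 : size m2 = size b1 by rewrite size_drop sm addKn.
exists (0 :: map S (mask m1 a)), (map S (mask m2 b1)), (map S (mask m2 b2)).
split; rewrite ?em ?mask_cat ?map_cat // !size_map !size_mask -?sb //.
apply: leq_trans (leq_sub2r _ le); rewrite -s2 last_cat.
case/lastP: (m2) => [//|m3 c]; rewrite last_rcons -cats1 count_cat size_cat /=.
by have := count_size id m3; case: c => /=; lia.
Qed.

Lemma agree_lift (b d : nat) (u v : seq nat) (w : walk) (p1 p2 : seq nat) :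
  u \in comps b -> is_walk b u v w -> is_state v p1 -> is_state v p2 ->
  agree d p1 p2 -> agree (d - ~~ top_fixing w) (lift w p1) (lift w p2).
Proof.
elim: w u => [|[m r] w IH] u hu /=; first by rewrite subn0.
move=> /and3P[hm hr hw] h1 h2 /(IH _ hr hw h1 h2).
have /and3P[/eqP sp _ _] := lift_state hr hw h1.
move=> /(agree_lift_card hm sp) [a [b1 [b2 [e1 e2 sb le]]]].
exists a, b1, b2; split=> //; apply: leq_trans le _.
rewrite -subnDA; apply: leq_sub2l; rewrite /top_fixing /=.
by case: (if m is Some _ then _ else _) => //=; case: (all _ _).
Qed.

Definition fixpt (u : seq nat) (w : walk) : seq nat :=
  iter (size u) (lift w) (iota 0 (size u)).

(* If some group is thrown out of the top position, each turn around the walk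
   determines one more entry, so an iterate of [lift w] is constant. *)
Lemma lift_fixpt (b : nat) (u : seq nat) (w : walk) :
  u \in comps b -> is_walk b u u w -> ~~ ((0 < b) && top_fixing w) ->
  [/\ is_state u (fixpt u w), lift w (fixpt u w) = fixpt u w &
      forall p, is_state u p -> lift w p = p -> p = fixpt u w].
Proof.
move=> hu hw ntw.
have u0 : all (leq 1) u by move: hu; rewrite mem_comps => /andP[].
have st0 : is_state u (iota 0 (size u)).
  by rewrite /is_state size_iota eqxx iota_ltn_sorted.
have st k p : is_state u p -> is_state u (iter k (lift w) p).
  by move=> hp; elim: k => //= k IH; exact: lift_state hu hw IH.
have ag k p1 p2 : is_state u p1 -> is_state u p2 ->
    agree (size u - k * ~~ top_fixing w) (iter k (lift w) p1) (iter k (lift w) p2).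
  move=> h1 h2; elim: k => [|k IH].
    exists [::], p1, p2; rewrite mul0n subn0.
    by case/and3P: h1 => /eqP -> _ _; case/and3P: h2 => /eqP -> _ _.
  by rewrite mulSn addnC subnDA; apply: (agree_lift hu hw) => //; apply: st.
have const p1 p2 : is_state u p1 -> is_state u p2 ->
    iter (size u) (lift w) p1 = iter (size u) (lift w) p2.
  move=> h1 h2; have [a [b1 [b2 [-> -> sb]]]] := ag (size u) _ _ h1 h2.
  have -> : size u - size u * ~~ top_fixing w = 0.
    (* If the top is fixed, then [b = 0], so [u] is empty and nothing has to be determined. *)
    move: ntw; case: top_fixing => /=; last by rewrite muln1 subnn.
    rewrite andbT -eqn0Ngt => /eqP b0; rewrite muln0 subn0.
    by case: u hu {hw u0 st0 st ag h1 h2} => // x u; rewrite b0 mem_comps /=; lia.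
  rewrite leqn0 size_eq0 => /eqP e1; rewrite e1 in sb *.
  by move/esym/eqP: sb; rewrite size_eq0 => /eqP ->.
split; first exact: st.
  (* [lift w (fixpt u w)] is the same iterate with another starting list. *)
  by rewrite /fixpt -iterS iterSr; apply: const => //; exact: lift_state hu hw st0.
by move=> p hp ep; rewrite -{1}(iter_fix (size u) ep); apply: const.
Qed.

Lemma last_lift (b : nat) (u v : seq nat) (w : walk) (p : seq nat) :
  u \in comps b -> is_walk b u v w -> is_state v p -> 0 < b -> top_fixing w ->
  last 0 (lift w p) = last 0 p + size w.
Proof.
move=> hu + hp b0; elim: w u hu => [|[m r] w IH] u hu /=; first by rewrite addn0.
move=> /and3P[hm hr hw] /andP[tm tw]; rewrite addnS -(IH _ hr hw tw).
have /and3P[/eqP + _ _] := lift_state hr hw hp.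
case/lastP: (lift w p) => [|s x] sp.
  case: r {hm hw} hr sp => // hr _.
  by move: hr b0; rewrite mem_comps /= => /andP[/eqP <-].
rewrite last_rcons; case: m hm tm => [m|] hm /= tm; last first.
  by rewrite map_rcons last_rcons.
have sm : size m = (size s).+1.
  by case: u hm {hu} => // y u /andP[/eqP -> _]; rewrite -sp size_rcons.
case/lastP: m tm sm {hm} => [//|m c]; rewrite last_rcons => ->.
rewrite size_rcons => -[sm]; rewrite mask_rcons //= cats1 map_rcons.
by rewrite last_rcons.
Qed.

Lemma top_fixing_no_fixpt (b : nat) (u : seq nat) (w : walk) (p : seq nat) :
  u \in comps b -> is_walk b u u w -> is_state u p -> 0 < size w ->
  lift w p = p -> ~~ ((0 < b) && top_fixing w).
Proof.
move=> hu hw hp w0 e; apply/negP => /andP[b0 tw].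
by have := last_lift hu hw hp b0 tw; rewrite e; lia.
Qed.

(** * Siteswaps read off walks *)

(* Balls due [i] beats after time [t], from the initial state [f] and throws [M]. *)
Definition flow (f : nat -> nat) (M : seq (seq nat)) (t i : nat) : nat :=
  f (i + t) + \sum_(j < t) count_mem (i + t - j) (nth [::] M j).

Lemma flow_cons (f : nat -> nat) (L : seq nat) (M : seq (seq nat)) (t i : nat) :
  flow f (L :: M) t.+1 i =
  flow (fun k => f k.+1 + count_mem k.+1 L) M t i.
Proof.
by rewrite /flow big_ord_recl /= subn0 addnA addnS.
Qed.

Lemma eq_flow (f g : nat -> nat) (M : seq (seq nat)) (t : nat) :
  f =1 g -> flow f M t =1 flow g M t.
Proof. by move=> e i; rewrite /flow e. Qed.

Fixpoint siteswap_of (u : seq nat) (w : walk) (p : seq nat) : seq (seq nat) :=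
  if w is (m, r) :: w' then
    throws u (lift w p) r (lift w' p) :: siteswap_of r w' p
  else [::].

Lemma size_siteswap_of (u : seq nat) (w : walk) (p : seq nat) :
  size (siteswap_of u w p) = size w.
Proof. by elim: w u => [|[m r] w IH] u //=; rewrite IH. Qed.

Definition throw_list (L : seq nat) : bool := sorted leq L && all (leq 1) L.

(** The last equation tracks the sum of the remaining times: throws add their heights, and each beat
    takes one from each of the [b] balls. *)
Lemma siteswap_ofP (b : nat) (u v : seq nat) (w : walk) (p : seq nat)
    (M := siteswap_of u w p) (f := due u (lift w p)) :
  u \in comps b -> is_walk b u v w -> is_state v p ->
  [/\ all throw_list M,
      forall t, t < size M -> size (nth [::] M t) = flow f M t 0,
      flow f M (size M) =1 due v p &
      \sum_(i <- lift w p) i * f i + \sum_(L <- M) sumn L =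
      \sum_(i <- p) i * due v p i + b * size M].
Proof.
rewrite {}/M {}/f; elim: w u => [|[m r] w IH] u hu /=.
  move=> /eqP -> hp; split=> //; last by rewrite big_nil muln0 !addn0.
  by move=> i; rewrite /flow big_ord0 !addn0.
move=> /and3P[hm hr hw] hp.
have hs := lift_state hr hw hp.
have hs' := lift_card_state hu hm hs.
have st := throws_step hs (lift_card_due hu hm hs).
have [a1 a2 a3 a4] := IH _ hr hw hp.
set L := throws _ _ _ _ in st *.
case: (st) => sL L0 e.
have [eu er] : sumn u = b /\ sumn r = b.
  by move: hu hr; rewrite !mem_comps => /andP[/eqP -> _] /andP[/eqP -> _].
have e' t : flow (due u (lift_card m (lift w p))) (L :: siteswap_of r w p) t.+1 =1
          flow (due r (lift w p)) (siteswap_of r w p) t.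
  by move=> i; rewrite flow_cons; apply: eq_flow => k; rewrite e.
split.
- by rewrite /= /throw_list sL L0.
- move=> [|t] ht /=; last by rewrite e' -a2.
  rewrite /flow big_ord0 !addn0; have := step_sumn hs' hs st.
  by rewrite eu er addnC => /addIn.
- by move=> i; rewrite e' a3.
rewrite big_cons /= sumnE addnA (step_sum id hs' hs st) mul0n add0n.
have -> : \sum_(i <- lift w p) i.+1 * due r (lift w p) i =
          b + \sum_(i <- lift w p) i * due r (lift w p) i.
  by rewrite -{1}er (sumn_due hs) -big_split; apply: eq_bigr => i _; rewrite mulSn.
by rewrite -addnA a4 mulnS; lia.
Qed.

(** The old state and the throws prescribe the next state as a finitely supported function. Throwing
    as many balls as land preserves the total, so a card realises the beat. *)
Lemma siteswap_of_surj (b : nat) (u p : seq nat) (M : seq (seq nat)) :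
  u \in comps b -> is_state u p -> all throw_list M ->
  (forall t, t < size M -> size (nth [::] M t) = flow (due u p) M t 0) ->
  exists v p' w, [/\ is_walk b u v w, is_state v p', p = lift w p' &
                     M = siteswap_of u w p'].
Proof.
elim: M u p => [|L M IH] u p hu hs.
  by move=> _ _; exists u, p, [::]; split=> //=.
move=> /= /andP[/andP[sL L0] aM] hM.
have [r [p1 [hs1 e]]] : exists r p1, is_state r p1 /\
    due r p1 =1 (fun i => due u p i.+1 + count_mem i.+1 L).
  apply: (@due_surj _ (sumn p + sumn L)) => i hi.
  rewrite due_out //; last by apply/negP => /leq_sumn; lia.
  by apply/count_memPn/negP => /leq_sumn; lia.
have st : step u p L r p1 by [].
have eur : sumn u = sumn r.
  have := step_sumn hs hs1 st; rewrite (hM 0) // /flow big_ord0 !addn0 addnC.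
  by move/addnI.
have hr : r \in comps b.
  move: hu; rewrite !mem_comps eur => /andP[-> _]; by case/and3P: hs1.
have [|m hm ep] := card_of_due hs hs1 eur; first by move=> i; rewrite e leq_addr.
have [|v [p' [w [hw hp' ep1 eM]]]] := IH r p1 hr hs1 aM.
  move=> t ht; rewrite (hM t.+1) // flow_cons; apply: eq_flow => i; by rewrite e.
exists v, p', ((m, r) :: w); split=> //=.
- by rewrite hm hr.
- by rewrite -ep1.
rewrite -eM -ep1 -ep; congr cons; apply: (step_inj st).
by apply: throws_step => // i; rewrite e leq_addr.
Qed.

(** The common state and the first multiset determine the next state, and the two states determine
    the card. *)
Lemma siteswap_of_inj (b : nat) (u v v' : seq nat) (w w' : walk) (p p' : seq nat) :
  u \in comps b -> is_walk b u v w -> is_walk b u v' w' ->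
  is_state v p -> is_state v' p' -> lift w p = lift w' p' ->
  siteswap_of u w p = siteswap_of u w' p' -> w = w'.
Proof.
move=> + + + hp hp'; elim: w w' u => [|[m r] w IH] [|[m' r'] w'] u hu //=.
move=> /and3P[hm hr hw] /and3P[hm' hr' hw'] el [eL eM].
have hs := lift_state hr hw hp; have hs' := lift_state hr' hw' hp'.
have [_ _ e] := throws_step hs (lift_card_due hu hm hs).
have [_ _ e'] := throws_step hs' (lift_card_due hu hm' hs').
have [er ew] : r = r' /\ lift w p = lift w' p'.
  by apply: (due_inj hs hs') => i; rewrite e e' el -eL el.
rewrite -{}er in hm' hw' eM *; rewrite -ew in el.
by rewrite (lift_card_inj hs hm hm' el) (IH w' r).
Qed.

(** * Recovering the periodic state from the throws *)

(** The throws of one period that are still in the air at its end, recorded by remaining time. *)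
Definition closing (M : seq (seq nat)) (i : nat) : nat :=
  flow (fun=> 0) M (size M) i.

(** Unrolls [f i = f (i + size M) + closing M i]. On a state the first term vanishes for large [N],
    so a periodic state is determined by [M]. *)
Lemma closed_flow (f : nat -> nat) (M : seq (seq nat)) (N i : nat) :
  flow f M (size M) =1 f ->
  f i = f (i + N * size M) + \sum_(K < N) closing M (i + K * size M).
Proof.
move=> e; elim: N => [|N IH]; first by rewrite big_ord0 mul0n !addn0.
have ej j : f j = f (j + size M) + closing M j by rewrite -{1}e.
by rewrite big_ord_recr /= IH ej mulSnr addnA addnAC addnA.
Qed.

Lemma closed_flow_inj (u p u' p' : seq nat) (M : seq (seq nat)) :
  0 < size M -> is_state u p -> is_state u' p' ->
  flow (due u p) M (size M) =1 due u p ->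
  flow (due u' p') M (size M) =1 due u' p' -> u = u' /\ p = p'.
Proof.
move=> M0 hs hs' e e'; apply: (due_inj hs hs') => i.
pose N := (sumn p + sumn p').+1.
have NM : N <= N * size M by rewrite leq_pmulr.
rewrite (closed_flow N i e) (closed_flow N i e') !due_out //.
  by apply/negP => /leq_sumn; rewrite /N in NM *; lia.
by apply/negP => /leq_sumn; rewrite /N in NM *; lia.
Qed.

(** A throw from beat [j] reaches residue [t] either in the same period, with [j < t], or [K.+1]
    periods later for exactly one [K]; the bound on [h] makes [K < N]. *)
Lemma sum_eq_residue (n N t j h : nat) : t < n -> j < n -> 0 < h <= N * n ->
  \sum_(K < N) (h == t + K * n + n - j) + (j < t) * (h == t - j) =
  ((j + h) %% n == t) :> nat.
Proof.
move=> tn jn /andP[h0 hN]; have n0 : 0 < n by apply: leq_ltn_trans tn.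
have ed := divn_eq (j + h) n; set k := (j + h) %/ n in ed.
case: (eqVneq ((j + h) %% n) t) => et; last first.
  rewrite big1 => [|K _].
    case: eqP => [e|]; last by rewrite muln0.
    case: ltnP => // jt; move: et; rewrite e subnKC ?modn_small ?eqxx //.
    exact: ltnW.
  case: eqP => // e; move: et; rewrite e.
  have -> : j + (t + K * n + n - j) = K.+1 * n + t by rewrite mulSn; lia.
  by rewrite modnMDl modn_small ?eqxx.
rewrite et in ed; case ek: k => [|k'].
  rewrite ek mul0n add0n in ed.
  have -> : (j < t) = true by lia.
  have -> : (h == t - j) = true by lia.
  by rewrite big1 // => K _; case: eqP => // e; lia.
rewrite ek mulSn in ed.
have kN : k' < N.
  rewrite -(ltn_pmul2r n0); nia.
rewrite (bigD1 (Ordinal kN)) //= big1 => [|K].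
  have -> : (h == t + k' * n + n - j) = true by lia.
  have -> : (h == t - j) = false by nia.
  by rewrite muln0.
rewrite -val_eqE /= => /eqP ne; case: eqP => // e.
have /eqP : K * n = k' * n by lia.
by rewrite eqn_pmul2r // => /eqP.
Qed.

(** The throws landing at beat [t] come from the current period or from one of the [N] before it. *)
Lemma count_landing (M : seq (seq nat)) (N t : nat) : t < size M ->
  (forall L h, L \in M -> h \in L -> 0 < h <= N * size M) ->
  \sum_(K < N) closing M (t + K * size M) +
  \sum_(j < t) count_mem (t - j) (nth [::] M j) =
  \sum_(j < size M) count (fun h => (j + h) %% size M == t) (nth [::] M j).
Proof.
move=> tM hM; set n := size M in tM hM *.
under eq_bigr => K _ do rewrite /closing /flow add0n.
rewrite exchange_big /=.
have -> : \sum_(j < t) count_mem (t - j) (nth [::] M j) =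
          \sum_(j < n) (j < t) * count_mem (t - j) (nth [::] M j).
  rewrite (big_ord_widen n (fun j => count_mem (t - j) (nth [::] M j)) (ltnW tM)).
  by rewrite big_mkcond; apply: eq_bigr => j _; case: ifP; rewrite ?mul1n.
rewrite -big_split; apply: eq_bigr => j _ /=.
have hL h : h \in nth [::] M j -> 0 < h <= N * n.
  by apply: hM; rewrite mem_nth.
elim: (nth [::] M j) hL => [|h L IH] hL /=.
  by rewrite big1 // muln0.
rewrite big_split /= mulnDr addnACA IH; last first.
  by move=> k hk; apply: hL; rewrite inE hk orbT.
by rewrite (sum_eq_residue tM (ltn_ord j)) // hL ?mem_head.
Qed.

(** * From fixed points to siteswaps and back *)

Lemma mss_of_walk (b n : nat) (u p : seq nat) (w : walk) :
  0 < n -> u \in comps b -> is_walk b u u w -> size w = n -> is_state u p ->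
  lift w p = p -> is_mss b n (siteswap_of u w p).
Proof.
move=> n0 hu hw sw hp ep.
have [aM hM closed energy] := siteswap_ofP hu hw hp.
set M := siteswap_of u w p in aM hM closed energy *.
have sM : size M = n by rewrite size_siteswap_of.
rewrite {}ep in hM closed energy.
have tl t : t < n -> throw_list (nth [::] M t).
  by move=> tn; apply: (allP aM); rewrite mem_nth ?sM.
split=> // [t /tl /andP[]//|t /tl /andP[]//|t tn|]; last first.
  (* The walk is closed, so the sums of remaining times at its two ends cancel. *)
  move/addnI: energy; rewrite sM => <-.
  by rewrite (big_nth [::]) big_mkord sM.
rewrite hM ?sM //.
(* [N] exceeds every due time and every height, so nothing reaches [N] periods ahead. *)
pose N := (sumn p + \sum_(L <- M) sumn L).+1.
have NM : N <= N * size M by rewrite leq_pmulr ?sM.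
rewrite /flow add0n (closed_flow N t closed) due_out //; last first.
  by apply/negP => /leq_sumn; rewrite /N in NM *; lia.
rewrite add0n (@count_landing M N t) ?sM // => L h hL hh.
have /andP[_ /allP ->//] := allP aM _ hL; rewrite /= -sM; apply: leq_trans NM.
have := leq_sumn hh; rewrite /N (big_rem L hL) /=; lia.
Qed.

Lemma walk_of_mss (b n : nat) (M : seq (seq nat)) : 0 < n -> is_mss b n M ->
  exists u p w, [/\ u \in comps b, is_walk b u u w, is_state u p, lift w p = p &
                    M = siteswap_of u w p].
Proof.
move=> n0 [sM srt pos land tot].
have aM : all throw_list M.
  by apply/(all_nthP [::]) => t; rewrite sM => tn; rewrite /throw_list srt // pos.
pose N := (\sum_(L <- M) sumn L).+1.
have hM L h : L \in M -> h \in L -> 0 < h < N.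
  move=> hL hh; have /andP[_ /allP ->//] := allP aM _ hL.
  by have := leq_sumn hh; rewrite /N (big_rem L hL) /=; lia.
have NM : N <= N * size M by rewrite leq_pmulr ?sM.
have closing0 i : N <= i -> closing M i = 0.
  move=> Ni; rewrite /closing /flow add0n big1 // => j _.
  apply/count_memPn/negP => /hM - /(_ (mem_nth _ (ltn_ord j))).
  by have := ltn_ord j; lia.
(* The only candidate, by [closed_flow]: the balls still in the air from all earlier periods. *)
pose f i := \sum_(K < N) closing M (i + K * size M).
have [u [p [hs ef]]] : exists u p, is_state u p /\ due u p =1 f.
  apply: (@due_surj _ N) => i Ni; rewrite /f big1 // => K _.
  by apply: closing0; apply: leq_trans Ni (leq_addr _ _).
have closed : flow (due u p) M (size M) =1 due u p.
  move=> i; rewrite (eq_flow _ _ ef) ef.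
  have -> : flow f M (size M) i = f (i + size M) + closing M i by [].
  (* A sum of [N.+1] terms is split at either end; its last term is 0. *)
  have := @big_ord_recr _ 0 addn N (fun K => closing M (i + K * size M)).
  rewrite big_ord_recl /= mul0n addn0 [closing M (i + N * _)]closing0; last first.
    exact: leq_trans NM (leq_addl _ _).
  rewrite addn0 -/(f i) => <-; rewrite addnC; congr addn; apply: eq_bigr => K _.
  by rewrite /bump mulSn addnA.
have hu : u \in comps (sumn u).
  by rewrite mem_comps eqxx; case/and3P: hs.
have [|v [p' [w [hw hp' ep eM]]]] := siteswap_of_surj hu hs aM.
  move=> t; rewrite sM => tn; rewrite land // /flow add0n ef /f.
  rewrite (@count_landing M N t) ?sM // => L h hL hh.
  have /andP[-> hN] := hM _ _ hL hh; rewrite /= -sM.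
  exact: leq_trans (ltnW hN) NM.
have [_ _ + energy] := siteswap_ofP hu hw hp'.
rewrite -ep -eM => closed'.
have [ev ep'] : u = v /\ p = p'.
  by apply: (due_inj hs hp') => i; rewrite -closed closed'.
rewrite -{}ev -{}ep' in ep hw eM energy.
(* The remaining times cancel, so the heights sum to [sumn u * n], which must be [b * n]. *)
have eb : sumn u = b.
  move: energy; rewrite -ep -eM => /addnI; rewrite sM.
  rewrite (big_nth [::]) big_mkord sM tot => /eqP.
  by rewrite eqn_pmul2r // => /eqP ->.
by exists u, p, w; rewrite -{1 2}eb; split.
Qed.

(** * The count *)

Local Open Scope ring_scope.

Theorem theorem7 (b n : nat) : (0 < n)%N ->
  exists S : seq (seq (seq nat)),
    [/\ uniq S,
        forall M, M \in S <-> is_mss b n M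
      & (size S)%:Z = \tr (Amx b ^+ n) - \sum_(i < b) \tr (Amx i ^+ n)].
Proof.
move=> n0.
pose fixing (x : seq nat * walk) := (0 < b)%N && top_fixing x.2.
pose W := [seq x <- closed_walks b n | ~~ fixing x].
pose phi (x : seq nat * walk) := siteswap_of x.1 x.2 (fixpt x.1 x.2).
have WP u w : (u, w) \in W ->
    [/\ u \in comps b, is_walk b u u w, size w = n, is_state u (fixpt u w) &
        lift w (fixpt u w) = fixpt u w].
  rewrite mem_filter mem_closed_walks => /andP[ntw /and3P[hu /eqP sw hw]].
  by have [] := lift_fixpt hu hw ntw.
exists (map phi W); split.
- rewrite map_inj_in_uniq ?filter_uniq ?closed_walks_uniq //.
  move=> [u w] [u' w'] /WP[hu hw sw hs ef] /WP[hu' hw' sw' hs' ef'].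
  rewrite /phi /= => eM.
  (* Both initial states are periodic under the same throws, hence equal. *)
  have [_ _ c _] := siteswap_ofP hu hw hs.
  have [_ _ c' _] := siteswap_ofP hu' hw' hs'.
  rewrite ef ef' -eM in c c'.
  have [|eu ep] := closed_flow_inj _ hs hs' c c'; first by rewrite size_siteswap_of sw.
  subst u'.
  by rewrite (siteswap_of_inj hu hw hw' hs hs' _ eM) // ef ef'.
- move=> M; split=> [/mapP[[u w] /WP[hu hw sw hs ef] ->]|hM].
    exact: mss_of_walk.
  have sM : size M = n by case: hM.
  have [u [p [w [hu hw hs ef eM]]]] := walk_of_mss n0 hM.
  have sw : size w = n by rewrite -sM eM size_siteswap_of.
  have inW : (u, w) \in W.
    rewrite mem_filter mem_closed_walks hu hw sw eqxx; apply/andP; split=> //.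
    by apply: (top_fixing_no_fixpt hu hw hs) => //; rewrite sw.
  apply/mapP; exists (u, w) => //; rewrite {1}eM /phi /=.
  have ntw : ~~ fixing (u, w) by move: inW; rewrite mem_filter => /andP[].
  (* Uniqueness of the fixed point identifies [p] with the one used by [phi]. *)
  by have [_ _ /(_ p hs ef) <-] := lift_fixpt hu hw ntw.
rewrite size_map -size_closed_walks.
have -> : \sum_(i < b) \tr (Amx i ^+ n) = (size (top_fixing_walks b n))%:Z.
  rewrite size_top_fixing_walks -natz raddf_sum; apply: eq_bigr => i _.
  by rewrite -size_closed_walks -natz.
rewrite -(count_predC fixing (closed_walks b n)) PoszD.
by rewrite /top_fixing_walks !size_filter addrAC subrr add0r.
Qed.
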